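(* Let $k\ge 1$ be an integer and $\lambda\in[0,1]$. Define $\beta(k)=\sum_{i=0}^{k-1}\lambda^{-i}$ if $\lambda>0$ and $\beta(k)=\infty$ if $\lambda=0$, and \[ \alpha(k)=\begin{cases}1+2\lambda+2\lambda^2+\dots+2\lambda^{(k-1)/2} & \text{if } k \text{ is odd},\\ 1+2\lambda+2\lambda^2+\dots+2\lambda^{k/2-1}+\lambda^{k/2} & \text{if } k \text{ is even.}\end{cases} \] Then there exists a deterministic learning-augmented memory-constrained online algorithm $\mathcal{A}$ for the $k$-server problem on the line such that for every instance $I$ and every prediction for $I$ with prediction error $\eta$, \[ \mathcal{A}(I)\le \min\left\{\alpha(k)\left(1+\frac{\eta}{\mathrm{OPT}(I)}\right),\ \beta(k)\right\}\cdot \mathrm{OPT}(I)+c, \] where $c\ge 0$ depends only on the initial configuration. In particular, for $\lambda>0$ the algorithm is $\alpha(k)$-consistent and $\beta(k)$-robust.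
   Context: The $k$-server problem on the line: $k$ servers start at given positions on $\mathbb{R}$ (initial configuration $C_0$); requests $r_1,\dots,r_n\in\mathbb{R}$ arrive online one by one, and each must be served (before the next is revealed) by moving at least one server to the requested point; cost is the total distance traveled by all servers. Servers are labeled by position, $s_1\le\dots\le s_k$ (overtakings are uncrossed). $\mathrm{OPT}(I)$ is the minimum cost of serving instance $I$ offline. A prediction for an instance with $n$ requests is a sequence $p_1,\dots,p_n\in\{1,\dots,k\}$; $s_{p_t}$ is the predicted server for request $t$. The algorithm FtP (''follow the predictions'') serves each request $r_t$ by moving server $s_{p_t}$ to it (then relabeling servers by position order); $\mathrm{FtP}(I)$ is its cost, and the prediction error is $\eta=\mathrm{FtP}(I)-\mathrm{OPT}(I)$. A learning-augmented algorithm receives $p_t$ together with $r_t$. It is $\alpha$-consistent if $\mathcal{A}(I)\le\alpha\,\mathrm{OPT}(I)+c$ for every instance and every prediction with $\eta=0$, and $\beta$-robust if $\mathcal{A}(I)\le\beta\,\mathrm{OPT}(I)+c$ for every instance and every prediction, where $c$ depends only on the initial configuration. An algorithm is memory-constrained if its decision on each request depends only on the current server configuration, the current request and the current prediction (not on previous requests); it may move several servers per request; and its memory is erasable: for any set of $k$ distinct points and any starting configuration there is a finite sequence of requests among these $k$ points after which each of these points holds exactly one server (such a sequence is called a force to these points). *)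

(* Defs.v *)
From HB Require Import structures.
From mathcomp Require Import all_boot all_order all_algebra.
From mathcomp Require Import classical_sets reals.
Set Implicit Arguments. Unset Strict Implicit. Unset Printing Implicit Defensive.
Import Order.TTheory GRing.Theory Num.Theory.
Local Open Scope ring_scope.
Local Open Scope classical_set_scope.

Section KServer.
Variable R : realType.

(* A configuration of k servers on the line: the list of their positions,
   labelled by position order s_1 <= ... <= s_k (index 0 is s_1). *)
Definition config_ok (k : nat) (C : seq R) : Prop :=
  size C = k /\ sorted <=%R C.

(* Cost of moving from configuration C to configuration C' (both sorted):
   since overtakings are uncrossed, server i travels from s_i to s'_i. *)
Definition move_cost (C C' : seq R) : R :=
  \sum_(i < size C) `|nth 0 C i - nth 0 C' i|.

Fixpoint sched_cost (C : seq R) (Cs : seq (seq R)) : R :=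
  match Cs with
  | [::] => 0
  | C' :: Cs' => move_cost C C' + sched_cost C' Cs'
  end.

Definition feasible_sched (k : nat) (rs : seq R) (Cs : seq (seq R)) : Prop :=
  size Cs = size rs /\
  (forall t, (t < size rs)%N ->
     config_ok k (nth [::] Cs t) /\ nth 0 rs t \in nth [::] Cs t).

Definition OPT (k : nat) (C0 : seq R) (rs : seq R) : R :=
  inf [set x | exists Cs, feasible_sched k rs Cs /\ x = sched_cost C0 Cs].

(* FtP: serve r_t by moving the predicted server s_{p_t} to r_t, then relabel
   servers by position order. Predictions are 0-based indices in 'I_k. *)
Fixpoint ftp_cost (k : nat) (C : seq R) (rs : seq R) (ps : seq 'I_k) : R :=
  match rs, ps with
  | r :: rs', p :: ps' =>
      `|nth 0 C p - r| + ftp_cost (sort <=%R (set_nth 0 C p r)) rs' ps'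
  | _, _ => 0
  end.

Definition pred_error (k : nat) (C0 rs : seq R) (ps : seq 'I_k) : R :=
  ftp_cost C0 rs ps - OPT k C0 rs.

(* A deterministic memory-constrained learning-augmented algorithm: given the
   current configuration, the current request and the current prediction, it
   returns the next configuration (it may move several servers). *)
Definition mc_alg (k : nat) := seq R -> R -> 'I_k -> seq R.

Fixpoint alg_final (k : nat) (A : mc_alg k) (C : seq R) (rs : seq R)
    (ps : seq 'I_k) : seq R :=
  match rs, ps with
  | r :: rs', p :: ps' => alg_final A (A C r p) rs' ps'
  | _, _ => C
  end.

Fixpoint alg_cost (k : nat) (A : mc_alg k) (C : seq R) (rs : seq R)
    (ps : seq 'I_k) : R :=
  match rs, ps with
  | r :: rs', p :: ps' => move_cost C (A C r p) + alg_cost A (A C r p) rs' ps'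
  | _, _ => 0
  end.

Definition serves (k : nat) (A : mc_alg k) : Prop :=
  forall C r p, config_ok k C -> config_ok k (A C r p) /\ r \in A C r p.

Definition erasable (k : nat) (A : mc_alg k) : Prop :=
  forall X : seq R, size X = k -> uniq X ->
  forall C, config_ok k C ->
  exists (rs : seq R) (ps : seq 'I_k),
    size ps = size rs /\ all (fun r => r \in X) rs /\
    alg_final A C rs ps = sort <=%R X.

Definition memory_constrained (k : nat) (A : mc_alg k) : Prop :=
  serves A /\ erasable A.

Definition alpha_k (lam : R) (k : nat) : R :=
  if odd k then 1 + 2 * \sum_(1 <= i < (k./2).+1) lam ^+ i
  else 1 + 2 * \sum_(1 <= i < k./2) lam ^+ i + lam ^+ (k./2).

(* beta(k), meaningful for lam > 0 (beta(k) = +infinity when lam = 0). *)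
Definition beta_k (lam : R) (k : nat) : R :=
  \sum_(0 <= i < k) (lam ^+ i)^-1.

(* The bound  min{alpha(k)(1 + eta/OPT), beta(k)} * OPT, written without
   division as min{alpha(k)(OPT + eta), beta(k) OPT}; when lam = 0 the beta
   term is +infinity and the min is the alpha term. *)
Definition perf_bound (lam : R) (k : nat) (opt eta : R) : R :=
  if 0 < lam then Num.min (alpha_k lam k * (opt + eta)) (beta_k lam k * opt)
  else alpha_k lam k * (opt + eta).

End KServer.

(* Main.v *)
Require Import Defs.
From HB Require Import structures.
From mathcomp Require Import all_boot all_order all_algebra.
From mathcomp Require Import classical_sets reals.
From mathcomp Require Import ring lra zify.
Import Order.TTheory GRing.Theory Num.Theory.
Local Open Scope ring_scope.
Set Implicit Arguments. Unset Strict Implicit. Unset Printing Implicit Defensive.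

(* The algorithm is Double Coverage with unequal speeds: of the two servers
   adjacent to a request, the one on the side of the predicted server moves at
   speed 1 and the other one at speed [lam], until one of them arrives.

   With respect to a reference configuration [x], both bounds use a potential
     sum_j w_j |s_j - x_j| + sum_j (g (j + 1) - g (k - j)) s_j   (ranks from 0)
   for a nondecreasing [g].  Against OPT, [g = beta] and
   [w_j = beta (j + 1) + beta (k - j) - 1 <= beta k]; against FtP, [w] is
   constantly [alpha k] and [g m] is [alpha (2 m - 1)], capped at [alpha k].
   Against FtP the matching can moreover be chosen so that the fast server
   approaches its partner.

   For erasability, request points [Y_j] with prediction [j].  FtP started at [Y]
   serves these for free, so the total movement of the algorithm is bounded, and
   after some point it is so small that server [j] stays close to [Y_j] and
   reaches it first.  The servers are then brought home from left to right. *)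

Local Ltac norm_lra :=
  repeat match goal with |- context [ `|?x| ] => case: (ger0P x) => ? end; lra.

(** * Sorted matchings *)

Lemma size_set_nth_ltn (T : Type) (x0 : T) (s : seq T) (i : nat) (x : T) :
  (i < size s)%N -> size (set_nth x0 s i x) = size s.
Proof. by move=> i_lt; rewrite size_set_nth (maxn_idPr i_lt). Qed.

Lemma set_nth_id (T : Type) (x0 : T) (s : seq T) (i : nat) :
  (i < size s)%N -> set_nth x0 s i (nth x0 s i) = s.
Proof.
move=> i_lt; apply: (@eq_from_nth _ x0) => [|j _]; first exact: size_set_nth_ltn.
by rewrite nth_set_nth /=; case: eqP => // ->.
Qed.

Lemma sum_set_nth (T : Type) (V : zmodType) (x0 : T) (F : nat -> T -> V)
    (s : seq T) (n i : nat) (x : T) : (i < n)%N ->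
  \sum_(j < n) F j (nth x0 (set_nth x0 s i x) j) =
  \sum_(j < n) F j (nth x0 s j) + (F i x - F i (nth x0 s i)).
Proof.
move=> i_lt; rewrite (bigD1 (Ordinal i_lt)) //= [in RHS](bigD1 (Ordinal i_lt)) //=.
rewrite nth_set_nth /= eqxx addrC [RHS]addrAC addrCA subrr addr0 addrC.
congr (_ + _); apply: eq_bigr => j.
by rewrite -val_eqE /= nth_set_nth /= => /negbTE ->.
Qed.

Lemma perm_set_nth_exchange (T : eqType) (x0 : T) (s : seq T) (p l : nat) (x : T) :
  (p < size s)%N -> (l < size s)%N ->
  perm_eq (set_nth x0 (set_nth x0 s p (nth x0 s l)) l x) (set_nth x0 s p x).
Proof.
move=> ps ls; apply/permP => a.
have s'l : nth x0 (set_nth x0 s p (nth x0 s l)) l = nth x0 s l.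
  by rewrite nth_set_nth /=; case: eqP.
have ls' : (l < size (set_nth x0 s p (nth x0 s l)))%N.
  by rewrite size_set_nth_ltn.
rewrite !count_set_nth_ltn // s'l.
have : (a (nth x0 s p) <= count a s)%N.
  case: (boolP (a _)) => // ap; rewrite -has_count.
  by apply/hasP; exists (nth x0 s p); rewrite ?mem_nth.
by case: (a (nth x0 s p)) (a (nth x0 s l)) (a x) => [] [] []; lia.
Qed.

Section MoveCost.
Variable R : realType.
Implicit Types (s t y z : seq R) (b r : R) (i j l p : nat).

Lemma config_le k s i j :
  config_ok k s -> (i <= j)%N -> (j < k)%N -> s`_i <= s`_j.
Proof.
move=> [size_s s_sorted] ij jk; apply: (sorted_leq_nth le_trans lexx) => //.
- by rewrite inE size_s (leq_ltn_trans ij).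
- by rewrite inE size_s.
Qed.

Lemma move_cost_ge0 s t : 0 <= move_cost s t.
Proof. exact: sumr_ge0. Qed.

Lemma norm_nth_le_move_cost s t i :
  (i < size s)%N -> `|s`_i - t`_i| <= move_cost s t.
Proof.
move=> i_lt; rewrite /move_cost (bigD1 (Ordinal i_lt)) //= lerDl.
exact: sumr_ge0.
Qed.

Lemma move_cost_cons (a b : R) s t :
  move_cost (a :: s) (b :: t) = `|a - b| + move_cost s t.
Proof. by rewrite /move_cost big_ord_recl. Qed.

Lemma move_cost_merge1 s t b :
  sorted <=%R s -> size s = (size t).+1 ->
  move_cost s (merge <=%R [:: b] t) <= move_cost s (b :: t).
Proof.
elim: t s b => [|c t IH] [|a [|a' s]] b //= /andP[aa' s_sorted] [size_s].
have [//|cb] := leP b c.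
have := IH (a' :: s) b s_sorted; rewrite /= size_s => /(_ erefl).
rewrite !move_cost_cons => le_tail.
have uncross : `|a - c| + `|a' - b| <= `|a - b| + `|a' - c| by norm_lra.
by move: le_tail uncross => /=; lra.
Qed.

Lemma sort_cons_merge b t :
  sort <=%R (b :: t) = merge <=%R [:: b] (sort <=%R t).
Proof.
apply: le_sorted_eq.
- exact: sort_le_sorted.
- by apply: merge_sorted; [exact: le_total| |exact: sort_le_sorted].
- rewrite perm_sym perm_merge perm_sym perm_sort /= perm_cons.
  by rewrite perm_sym perm_sort.
Qed.

Lemma move_cost_sort s t :
  sorted <=%R s -> size s = size t ->
  move_cost s (sort <=%R t) <= move_cost s t.
Proof.
elim: t s => [|b t IH] [|a s] //= s_sorted [size_s]; rewrite sort_cons_merge.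
apply: (le_trans (move_cost_merge1 _ _ _)) => //; first by rewrite size_sort /= size_s.
by rewrite !move_cost_cons lerD2l; apply: IH => //; apply: path_sorted s_sorted.
Qed.

(* When the predicted FtP server jumps to [r], the matching is repaired so that
   [r] is matched to a server lying on the way. *)
Lemma move_cost_rematch s y p l r :
  size s = size y -> (p < size y)%N -> (l < size y)%N ->
  (s`_p <= s`_l <= r) || (r <= s`_l <= s`_p) ->
  exists z, [/\ perm_eq z (set_nth 0 y p r), z`_l = r &
    move_cost s z <= move_cost s y + `|y`_p - r|].
Proof.
move=> size_s py ly between; exists (set_nth 0 (set_nth 0 y p (nth 0 y l)) l r).
split; first exact: perm_set_nth_exchange.
  by rewrite nth_set_nth /= eqxx.
rewrite /move_cost size_s !(sum_set_nth 0 (fun j (t : R) => `|s`_j - t|)) //.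
have -> : (set_nth 0 y p (nth 0 y l))`_l = y`_l by rewrite nth_set_nth /=; case: eqP.
have on_the_way : `|s`_p - s`_l| + `|s`_l - r| = `|s`_p - r|.
  by case/orP: between => /andP[? ?]; norm_lra.
by have := ler_distD s`_l s`_p y`_l; have := ler_distD y`_p s`_p r; lra.
Qed.

End MoveCost.

(** * Closing in on a request *)

(* Gap [i] lies between servers [i - 1] and [i]; servers beyond the ends do not
   exist, so gaps [0] and [size s] have a single neighbour. *)
Definition advance (R : realType) (s : seq R) (i : nat) (a b : R) : seq R :=
  mkseq (fun j => s`_j + a *+ (j.+1 == i) - b *+ (j == i)) (size s).

(* If [r] is occupied, [i] is the gap just to the left of [r] and [a = b = 0]. *)
Record pincer (R : realType) (s : seq R) (r : R) (i : nat) (a b : R) : Prop :=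
  Pincer {
    pincer_gap : forall j, (j < size s)%N -> (s`_j < r) = (j < i)%N;
    pincer_size : (i <= size s)%N;
    pincer_left_ge0 : 0 <= a;
    pincer_right_ge0 : 0 <= b;
    pincer_no_left : i = 0%N -> a = 0;
    pincer_no_right : i = size s -> b = 0;
    pincer_left_stop : (0 < i)%N -> s`_i.-1 + a <= r;
    pincer_right_stop : (i < size s)%N -> r <= s`_i - b;
    pincer_hit : (0 < i)%N /\ s`_i.-1 + a = r \/
                 (i < size s)%N /\ s`_i - b = r }.

Lemma pincer_count (R : realType) (s : seq R) (r a b : R) (i := count (< r) s) :
  sorted <=%R s -> 0 <= a -> 0 <= b -> (i = 0%N -> a = 0) -> (i = size s -> b = 0) ->
  ((0 < i)%N -> s`_i.-1 + a <= r) -> ((i < size s)%N -> r <= s`_i - b) ->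
  (0 < i)%N /\ s`_i.-1 + a = r \/ (i < size s)%N /\ s`_i - b = r ->
  pincer s r i a b.
Proof.
move=> s_sorted *; split=> //; last exact: count_size.
move=> j js; have [ji|ij] := ltnP j i; first exact: nth_count_lt.
by apply/negbTE; rewrite -leNgt nth_count_ge // ij.
Qed.

Lemma pincer_between (R : realType) (s : seq R) (r a b : R) (i := count (< r) s) :
  sorted <=%R s -> (0 < i < size s)%N -> 0 <= a <= r - s`_i.-1 -> 0 <= b <= s`_i - r ->
  a = r - s`_i.-1 \/ b = s`_i - r -> pincer s r i a b.
Proof.
move=> s_sorted /andP[i_gt0 i_lt] /andP[a_ge0 a_le] /andP[b_ge0 b_le] hit.
apply: pincer_count; rewrite -/i //; try lra; try lia.
by case: hit => ->; [left | right]; split=> //; ring.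
Qed.

Section Pincer.
Variables (R : realType) (s : seq R) (r : R) (i : nat) (a b : R).
Hypothesis moving : pincer s r i a b.
Notation s' := (advance s i a b).

Lemma size_advance : size s' = size s.
Proof. exact: size_mkseq. Qed.

Lemma nth_advance j : (j < size s)%N ->
  s'`_j = s`_j + a *+ (j.+1 == i) - b *+ (j == i).
Proof. exact: nth_mkseq. Qed.

Lemma advance_left : (0 < i)%N -> s'`_i.-1 = s`_i.-1 + a.
Proof.
move=> i_gt0; have i_le := pincer_size moving.
rewrite nth_advance ?prednK // eqxx (_ : i.-1 == i = false); last by lia.
by rewrite mulr1n mulr0n subr0.
Qed.

Lemma advance_right : (i < size s)%N -> s'`_i = s`_i - b.
Proof.
move=> i_lt; rewrite nth_advance // eqxx (_ : i.+1 == i = false); last by lia.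
by rewrite mulr1n mulr0n addr0.
Qed.

Lemma advance_other j : (j < size s)%N -> j.+1 != i -> j != i -> s'`_j = s`_j.
Proof.
by move=> j_lt /negbTE ji /negbTE ji'; rewrite nth_advance // ji ji' subr0 addr0.
Qed.

Lemma mem_advance : r \in s'.
Proof.
case: (pincer_hit moving) => -[i_in hit]; apply/(nthP 0); rewrite size_advance.
- by exists i.-1; rewrite ?advance_left // prednK ?(pincer_size moving).
- by exists i; rewrite ?advance_right.
Qed.

Lemma config_advance k : config_ok k s -> config_ok k s'.
Proof.
move=> s_ok; have [size_s _] := s_ok; split; first by rewrite size_advance.
apply/(sortedP 0) => j; rewrite size_advance => j_lt.
have := @config_le _ _ _ j j.+1 s_ok (leqnSn j); rewrite -size_s => /(_ j_lt).
have := (pincer_left_ge0 moving, pincer_right_ge0 moving) => -[a_ge0 b_ge0].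
rewrite !nth_advance //; last exact: ltnW.
have [ij|ij|iE] := ltngtP i j.+1.
- rewrite (_ : (j.+2 == i) = false); last lia.
  by rewrite mulr0n !addr0 subr0; case: eqP => _; rewrite ?subr0 ?mulr1n; lra.
- rewrite (_ : (j == i) = false); last lia.
  by rewrite mulr0n !addr0 !subr0; case: eqP => _; rewrite ?addr0 ?mulr1n; lra.
- have := pincer_left_stop moving; have := pincer_right_stop moving.
  rewrite iE /= => /(_ j_lt) right_stop /(_ isT) left_stop _.
  by rewrite (ltn_eqF (ltnSn j)) (gtn_eqF (ltnSn j.+1)) addr0 subr0 !mulr1n; lra.
Qed.

Lemma sum_advance (F : nat -> R -> R) :
  \sum_(j < size s) F j s'`_j =
  \sum_(j < size s) F j s`_j + (F i.-1 (s`_i.-1 + a) - F i.-1 s`_i.-1)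
    + (F i (s`_i - b) - F i s`_i).
Proof.
set left_gain := F i.-1 _ - _; set right_gain := F i _ - _.
have sum_pick n l x : \sum_(j < n) x *+ (j == l :> nat) = x *+ (l < n) :> R.
  by under eq_bigr do rewrite mulrb; rewrite -big_mkcond /= big_ord1_eq mulrb.
transitivity (\sum_(j < size s)
    (F j s`_j + left_gain *+ (j.+1 == i) + right_gain *+ (j == i :> nat))).
  apply: eq_bigr => j _; rewrite nth_advance // /left_gain /right_gain.
  have [<-|_] := eqVneq j.+1 i.
    by rewrite ltn_eqF // !mulr1n !mulr0n subr0 addr0 [RHS]addrC subrK.
  have [->|_] := eqVneq (j : nat) i.
    by rewrite !mulr1n !mulr0n !addr0 [RHS]addrC subrK.
  by rewrite !mulr0n subr0 !addr0.
rewrite !big_split /= sum_pick; congr (_ + _ + _).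
- rewrite /left_gain; case: i (pincer_no_left moving) (pincer_size moving) => [|m] /=.
    by move=> -> // _; rewrite addr0 subrr big1 // => j _; rewrite mul0rn.
  by move=> _ m_lt; under eq_bigr do rewrite eqSS; rewrite sum_pick m_lt.
- rewrite /right_gain; have := pincer_size moving; rewrite leq_eqVlt.
  case/predU1P => [iE|-> //].
  by rewrite (pincer_no_right moving iE) subr0 subrr mul0rn.
Qed.

Lemma move_cost_advance : move_cost s s' = a + b.
Proof.
rewrite /move_cost (sum_advance (fun j t => `|s`_j - t|)) big1 => [|j _].
  rewrite !subrr normr0 !subr0 add0r opprD addrA subrr add0r normrN opprB addrC.
  rewrite [s`_i + _]addrC subrK addrC.
  by rewrite !ger0_norm ?(pincer_left_ge0 moving) ?(pincer_right_ge0 moving).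
by rewrite subrr normr0.
Qed.

End Pincer.

(** * Potentials *)

Definition spread (R : realType) (g : nat -> R) (k : nat) (s : seq R) : R :=
  \sum_(j < k) (g j.+1 - g (k - j)%N) * s`_j.

(* For [w] constantly [k] and [g = id] this is the potential of Double Coverage:
   [spread] is then the sum of all pairwise distances. *)
Definition potential (R : realType) (w g : nat -> R) (k : nat) (s x : seq R) : R :=
  \sum_(j < k) w j * `|s`_j - x`_j| + spread g k s.

Section Potential.
Variables (R : realType) (w g : nat -> R) (k : nat).

Lemma spread_ge0 (s : seq R) :
  {homo g : m n / (m <= n)%N >-> m <= n} -> config_ok k s -> 0 <= spread g k s.
Proof.
move=> g_homo s_ok; suff: 0 <= spread g k s + spread g k s by lra.
rewrite {2}/spread (reindex_inj rev_ord_inj) /= -big_split /=.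
apply: sumr_ge0 => j _; have jk := ltn_ord j.
have -> : (k - j.+1).+1 = (k - j)%N by lia.
have -> : (k - (k - j.+1) = j.+1)%N by lia.
rewrite [leRHS](_ : _ = (g j.+1 - g (k - j)%N) * (s`_j - s`_(k - j.+1))); last by ring.
have [j_le|j_ge] := leqP (k - j) j.+1.
  by rewrite mulr_ge0 ?subr_ge0 ?g_homo // (config_le s_ok); lia.
rewrite mulr_le0 ?subr_le0 ?g_homo //; first exact: ltnW.
by rewrite (config_le s_ok); lia.
Qed.

Lemma potential_ge0 (s x : seq R) :
  {homo g : m n / (m <= n)%N >-> m <= n} ->
  (forall j, (j < k)%N -> 0 <= w j) -> config_ok k s -> 0 <= potential w g k s x.
Proof.
move=> g_homo w_ge0 s_ok; apply: addr_ge0; last exact: spread_ge0.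
by apply: sumr_ge0 => j _; rewrite mulr_ge0 ?w_ge0.
Qed.

Variables (s x : seq R) (r : R) (i : nat) (a b : R).
Hypotheses (size_s : size s = k) (moving : pincer s r i a b).

Lemma potential_advance :
  potential w g k (advance s i a b) x = potential w g k s x
    + w i.-1 * (`|s`_i.-1 + a - x`_i.-1| - `|s`_i.-1 - x`_i.-1|)
    + w i * (`|s`_i - b - x`_i| - `|s`_i - x`_i|)
    + (g i - g (k - i).+1) * a - (g i.+1 - g (k - i)%N) * b.
Proof.
rewrite /potential /spread -size_s.
rewrite (sum_advance moving (fun j t => w j * `|t - x`_j|)).
rewrite (sum_advance moving (fun j t => (g j.+1 - g (size s - j)%N) * t)).
have -> : (g i.-1.+1 - g (size s - i.-1)%N) * (s`_i.-1 + a)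
    - (g i.-1.+1 - g (size s - i.-1)%N) * s`_i.-1 = (g i - g (size s - i).+1) * a.
  case: i moving => [|m] m_moving /=.
    by rewrite (pincer_no_left m_moving) // addr0 subrr mulr0.
  by rewrite subnSK ?(pincer_size m_moving) //; ring.
by ring.
Qed.

Lemma potential_advance_left : (0 < i)%N -> 0 <= w i -> s`_i.-1 + a <= x`_i.-1 ->
  move_cost s (advance s i a b) + potential w g k (advance s i a b) x <=
  potential w g k s x + (1 - w i.-1 + g i - g (k - i).+1) * a
    + (1 + w i - g i.+1 + g (k - i)%N) * b.
Proof.
move=> i_gt0 wi_ge0 left_le; rewrite (move_cost_advance moving) potential_advance.
have a_ge0 := pincer_left_ge0 moving; have b_ge0 := pincer_right_ge0 moving.
rewrite (ler0_norm (x := _ + a - _)); last by lra.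
rewrite (ler0_norm (x := s`_i.-1 - _)); last by lra.
have : w i * `|s`_i - b - x`_i| <= w i * (`|s`_i - x`_i| + b).
  by rewrite ler_wpM2l // addrAC (le_trans (ler_normB _ _)) // (ger0_norm b_ge0).
lra.
Qed.

Lemma potential_advance_right :
  0 <= w i.-1 -> x`_i <= s`_i - b ->
  move_cost s (advance s i a b) + potential w g k (advance s i a b) x <=
  potential w g k s x + (1 + w i.-1 + g i - g (k - i).+1) * a
    + (1 - w i - g i.+1 + g (k - i)%N) * b.
Proof.
move=> wi_ge0 right_ge; rewrite (move_cost_advance moving) potential_advance.
have a_ge0 := pincer_left_ge0 moving; have b_ge0 := pincer_right_ge0 moving.
rewrite (ger0_norm (x := _ - b - _)); last by lra.
rewrite (ger0_norm (x := s`_i - _)); last by lra.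
have : w i.-1 * `|s`_i.-1 + a - x`_i.-1| <= w i.-1 * (`|s`_i.-1 - x`_i.-1| + a).
  by rewrite ler_wpM2l // addrAC (le_trans (ler_normD _ _)) // (ger0_norm a_ge0).
lra.
Qed.

End Potential.

(** * Double coverage with unequal speeds *)

(* The distance covered by the fast server until it has travelled [f] or the
   slow one, moving at relative speed [lam], has travelled [d]. *)
Definition fast_travel (R : realFieldType) (lam f d : R) : R :=
  if lam * f <= d then f else d / lam.

Lemma fast_travelP (R : realFieldType) (lam f d : R) :
  0 <= lam -> 0 <= f -> 0 <= d ->
  let t := fast_travel lam f d in
  [/\ 0 <= t, t <= f, lam * t <= d & t = f \/ lam * t = d].
Proof.
move=> lam_ge0 f_ge0 d_ge0; rewrite /fast_travel.
case: ifPn => [lamf_le|]; first by split=> //; left.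
rewrite -ltNge => d_lt.
have lam_gt0 : 0 < lam.
  rewrite lt0r lam_ge0 andbT; apply: contraTneq d_lt => ->.
  by rewrite mul0r -leNgt.
have lamt : lam * (d / lam) = d by rewrite mulrC divfK ?gt_eqF.
split; rewrite ?lamt ?divr_ge0 //; last by right.
by rewrite ler_pdivrMr // mulrC ltW.
Qed.

Definition lambda_dc (R : realType) (lam : R) (k : nat) : mc_alg R k :=
  fun C r p =>
  let i := count (< r) C in
  let a := r - C`_i.-1 in
  let b := C`_i - r in
  let: (da, db) :=
    if r \in C then (0, 0)
    else if i == 0%N then (0, b)
    else if i == k then (a, 0)
    else if (p < i)%N then let t := fast_travel lam a b in (t, lam * t)
    else let t := fast_travel lam b a in (lam * t, t) in
  advance C i da db.

Section LambdaDC.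
Variables (R : realType) (lam : R) (k : nat).

Lemma lambda_dcP (C : seq R) (r : R) (p : 'I_k) :
  0 <= lam -> config_ok k C ->
  exists i a b, [/\ pincer C r i a b,
    (0 < i < k)%N -> if (p < i)%N then b = lam * a else a = lam * b &
    lambda_dc lam C r p = advance C i a b].
Proof.
move=> lam_ge0 [size_C C_sorted]; rewrite /lambda_dc; set i := count _ C.
have below : (0 < i)%N -> C`_i.-1 < r.
  by move=> i_gt0; apply: nth_count_lt => //; rewrite prednK.
have above : (i < size C)%N -> r <= C`_i by move=> i_lt; rewrite nth_count_ge ?leqnn.
have k_gt0 : (0 < k)%N by apply: leq_ltn_trans (ltn_ord p).
case: ifP => [rC|_].
  have i_lt : (i < count (<= r) C)%N by rewrite count_lt_le_mem.
  have Ci : C`_i = r by apply: nth_count_eq; rewrite ?leqnn.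
  have i_size := leq_trans i_lt (count_size (<= r) C).
  exists i, 0, 0; split=> //; last by case: ifP; rewrite mulr0.
  apply: pincer_count => //; rewrite -/i ?addr0 ?subr0 ?Ci //; last by right.
  by move=> /below/ltW.
case: eqP => [i0|/eqP]; last rewrite -lt0n => i_gt0.
  exists i, 0, (C`_i - r); split=> //; last by rewrite i0.
  have i_size : (i < size C)%N by rewrite i0 size_C.
  apply: pincer_count => //; rewrite -/i ?subr_ge0 ?above ?subKr ?i0 ?size_C //.
  - by move=> k0; rewrite -k0 in k_gt0.
  - by right.
case: eqP => [ik|/eqP i_neq].
  exists i, (r - C`_i.-1), 0; split=> //; last by rewrite ik ltnn andbF.
  have hit : C`_i.-1 + (r - C`_i.-1) = r by ring.
  apply: pincer_count => //; rewrite -/i ?subr_ge0 ?(ltW (below _)) ?hit //.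
  - by move=> i0; rewrite i0 in i_gt0.
  - by rewrite ik size_C ltnn.
  - by left.
have i_lt : (i < size C)%N by rewrite ltn_neqAle size_C i_neq -size_C count_size.
have a_ge0 : 0 <= r - C`_i.-1 by rewrite subr_ge0 ltW ?below.
have b_ge0 : 0 <= C`_i - r by rewrite subr_ge0 above.
case: ifP => pi.
- set t := fast_travel lam _ _.
  have [t_ge0 t_le lamt_le hit] := fast_travelP lam_ge0 a_ge0 b_ge0.
  exists i, t, (lam * t); rewrite pi; split=> //.
  by apply: pincer_between; rewrite -/i ?i_gt0 ?mulr_ge0 ?t_ge0.
- set t := fast_travel lam _ _.
  have [t_ge0 t_le lamt_le hit] := fast_travelP lam_ge0 b_ge0 a_ge0.
  exists i, (lam * t), t; rewrite pi; split=> //.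
  by apply: pincer_between; rewrite -/i ?i_gt0 ?mulr_ge0 ?t_ge0 //; apply/or_comm.
Qed.

Lemma lambda_dc_serves : 0 <= lam -> serves (@lambda_dc R lam k).
Proof.
move=> lam_ge0 C r p C_ok.
have [i [a [b [moving _ ->]]]] := lambda_dcP r p lam_ge0 C_ok.
by split; [apply: config_advance moving _ C_ok | apply: mem_advance moving].
Qed.

End LambdaDC.

(** * Comparison with FtP *)

Definition alpha_sum (R : pzSemiRingType) (lam : R) (n : nat) : R :=
  \sum_(i < n) lam ^+ uphalf i.

Definition capped_alpha (R : pzSemiRingType) (lam : R) (k m : nat) : R :=
  alpha_sum lam (minn k m.*2.-1).

Section AlphaSum.
Variables (R : realFieldType) (lam : R).
Hypothesis lam_ge0 : 0 <= lam.

Lemma alpha_sumS n : alpha_sum lam n.+1 = alpha_sum lam n + lam ^+ uphalf n.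
Proof. exact: big_ord_recr. Qed.

Lemma alpha_sumSS n : alpha_sum lam n.+2 = 1 + lam + lam * alpha_sum lam n.
Proof.
rewrite /alpha_sum !big_ord_recl /= expr0 expr1 addrA mulr_sumr; congr (_ + _).
by apply: eq_bigr => i _; rewrite -exprS.
Qed.

Lemma alpha_sum_homo : {homo alpha_sum lam : m n / (m <= n)%N >-> m <= n}.
Proof.
apply: homo_leq => [//||n]; first exact: le_trans.
by rewrite alpha_sumS lerDl exprn_ge0.
Qed.

Lemma alpha_sum_ge0 n : 0 <= alpha_sum lam n.
Proof. by apply: sumr_ge0 => i _; rewrite exprn_ge0. Qed.

Lemma alpha_sum_le n : (1 - lam) * alpha_sum lam n <= 1 + lam.
Proof. by have := alpha_sum_homo (leqW (leqnSn n)); rewrite alpha_sumSS; lra. Qed.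

Lemma capped_alpha_homo k : {homo capped_alpha lam k : m n / (m <= n)%N >-> m <= n}.
Proof. by move=> m n mn; apply: alpha_sum_homo; lia. Qed.

Lemma capped_alpha_top k m : (k < m.*2)%N -> capped_alpha lam k m = alpha_sum lam k.
Proof. by move=> km; rewrite /capped_alpha (_ : minn _ _ = k) //; lia. Qed.

Lemma capped_alpha1 k : (0 < k)%N -> capped_alpha lam k 1 = 1.
Proof.
move=> k_gt0; rewrite /capped_alpha (_ : minn _ _ = 1%N); last by lia.
by rewrite /alpha_sum big_ord1 expr0.
Qed.

Lemma capped_alphaS k m : (0 < m)%N -> (m.*2 < k)%N ->
  capped_alpha lam k m.+1 = 1 + lam + lam * capped_alpha lam k m.
Proof.
move=> m_gt0 mk; rewrite /capped_alpha -alpha_sumSS; congr alpha_sum; lia.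
Qed.

(* With [n] servers on the slow side of the gap and [i] on the fast side, this
   says that the potential pays for the fast server moving by [1] and the slow
   one by [lam]. *)
Lemma capped_alpha_balance i n (k := (i + n)%N) :
  lam <= 1 -> (0 < i)%N -> (0 < n)%N ->
  1 - alpha_sum lam k + capped_alpha lam k i - capped_alpha lam k n.+1
    + (1 + alpha_sum lam k - capped_alpha lam k i.+1 + capped_alpha lam k n) * lam
  <= 0.
Proof.
move=> lam_le1 i_gt0 n_gt0; have [i_lt|n_lt|iE] := ltngtP i n.
- rewrite !(@capped_alpha_top k n) ?(@capped_alpha_top k n.+1); try lia.
  rewrite capped_alphaS //; last by lia.
  have : capped_alpha lam k i.+1 <= alpha_sum lam k by apply: alpha_sum_homo; lia.
  rewrite capped_alphaS //; last by lia.
  have : (1 - lam) * capped_alpha lam k i <= 1 + lam := alpha_sum_le _.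
  nra.
- rewrite !(@capped_alpha_top k i) ?(@capped_alpha_top k i.+1); try lia.
  by rewrite capped_alphaS //; [lra | lia].
- rewrite iE (@capped_alpha_top k n.+1); last by lia.
  have alphaE : alpha_sum lam k = capped_alpha lam k n + lam ^+ n.
    rewrite /capped_alpha (_ : k = n.*2.-1.+1); last by lia.
    by rewrite alpha_sumS; congr (alpha_sum _ _ + _ ^+ _); lia.
  have : alpha_sum lam k.+1 = 1 + lam + lam * capped_alpha lam k n.
    by rewrite -alpha_sumSS; congr alpha_sum; lia.
  rewrite alpha_sumS (_ : uphalf k = n) ?alphaE; last by lia.
  lra.
Qed.

Lemma capped_alpha_pays i n (f d : R) (k := (i + n)%N) :
  lam <= 1 -> (0 < i)%N -> 0 <= f -> ((0 < n)%N -> d = lam * f) -> (n = 0%N -> d = 0) ->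
  (1 - alpha_sum lam k + capped_alpha lam k i - capped_alpha lam k n.+1) * f
    + (1 + alpha_sum lam k - capped_alpha lam k i.+1 + capped_alpha lam k n) * d
  <= 0.
Proof.
move=> lam_le1 i_gt0 f_ge0 speed none; have [n0|n_gt0] := posnP n.
  rewrite (none n0) n0 capped_alpha1; last by lia.
  by rewrite (@capped_alpha_top _ i); [lra | lia].
rewrite (speed n_gt0) mulrA -mulrDl mulr_le0_ge0 //.
exact: capped_alpha_balance.
Qed.

End AlphaSum.

Lemma alpha_kE (R : realType) (lam : R) (n : nat) :
  (0 < n)%N -> alpha_k lam n = alpha_sum lam n.
Proof.
have odd_case m : alpha_sum lam m.*2.+1 = 1 + 2 * \sum_(1 <= i < m.+1) lam ^+ i.
  elim: m => [|m IH]; first by rewrite /alpha_sum big_ord1 big_geq // mulr0 addr0.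
  rewrite doubleS alpha_sumS [alpha_sum _ _.+2]alpha_sumS IH [in RHS]big_nat_recr //.
  have -> : uphalf m.*2.+1 = m.+1 by lia.
  have -> : uphalf m.*2.+2 = m.+1 by lia.
  by rewrite /=; ring.
rewrite /alpha_k -[in (0 < n)%N](odd_double_half n).
rewrite -[in alpha_sum _ n](odd_double_half n); case: (odd n) => /= [_|].
  by rewrite odd_case.
case: (n./2) => // m _; rewrite doubleS alpha_sumS odd_case.
by congr (_ + _ ^+ _); lia.
Qed.

Definition ftp_potential (R : realType) (lam : R) (k : nat) : seq R -> seq R -> R :=
  potential (fun=> alpha_sum lam k) (capped_alpha lam k) k.

Section FtP.
Variables (R : realType) (lam : R) (k : nat).
Hypothesis lam01 : 0 <= lam <= 1.
Let lam_ge0 : 0 <= lam. Proof. by case/andP: lam01. Qed.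
Let alpha_ge0 : 0 <= alpha_sum lam k. Proof. exact: alpha_sum_ge0. Qed.

Lemma ftp_potential_ge0 s x : config_ok k s -> 0 <= ftp_potential lam k s x.
Proof. by apply: potential_ge0 => //; apply: capped_alpha_homo. Qed.

Lemma ftp_potential_le_move_cost s x x' c :
  size s = k -> move_cost s x <= move_cost s x' + c ->
  ftp_potential lam k s x <= ftp_potential lam k s x' + alpha_sum lam k * c.
Proof.
move=> size_s; rewrite /move_cost size_s => cost_le.
rewrite /ftp_potential /potential -!mulr_sumr.
by rewrite addrAC lerD2r -mulrDr ler_wpM2l.
Qed.

Lemma ftp_potential_rematch s s' y p l r :
  config_ok k s -> config_ok k s' -> size y = k -> (p < k)%N -> (l < k)%N ->
  (s`_p <= s`_l <= r) || (r <= s`_l <= s`_p) ->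
  exists z, [/\ z`_l = r,
    ftp_potential lam k s' (sort <=%R (set_nth 0 y p r)) <= ftp_potential lam k s' z &
    ftp_potential lam k s z <=
      ftp_potential lam k s y + alpha_sum lam k * `|y`_p - r|].
Proof.
move=> [size_s _] [size_s' s'_sorted] size_y pk lk between.
have [||||z [perm_z zl cost_z]] := @move_cost_rematch R s y p l r; rewrite ?size_y //.
exists z; split=> //; last exact: ftp_potential_le_move_cost.
rewrite -(perm_sort_leP _ _ perm_z) -[leRHS]addr0 -(mulr0 (alpha_sum lam k)).
apply: ftp_potential_le_move_cost => //; rewrite addr0 move_cost_sort //.
by rewrite (perm_size perm_z) size_set_nth_ltn size_y.
Qed.

Section Step.
Variables (C y : seq R) (r : R) (p i : nat) (a b : R).
Hypotheses (C_ok : config_ok k C) (size_y : size y = k) (pk : (p < k)%N).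
Hypothesis moving : pincer C r i a b.
Notation C' := (advance C i a b).
Let size_C : size C = k. Proof. exact: (proj1 C_ok). Qed.
Let C'_ok : config_ok k C'. Proof. exact: config_advance moving _ C_ok. Qed.
Let i_le : (i <= k)%N. Proof. by rewrite -size_C (pincer_size moving). Qed.
Let lam_le1 : lam <= 1. Proof. by case/andP: lam01. Qed.

Lemma ftp_potential_step_left :
  (p < i)%N -> ((0 < i < k)%N -> b = lam * a) ->
  move_cost C C' + ftp_potential lam k C' (sort <=%R (set_nth 0 y p r)) <=
  ftp_potential lam k C y + alpha_sum lam k * `|y`_p - r|.
Proof.
move=> p_lt speed; have i_gt0 : (0 < i)%N by lia.
have left_lt : C`_i.-1 < r by rewrite (pincer_gap moving) ?size_C; lia.
have [||z [zi le_z z_le]] :=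
  @ftp_potential_rematch C C' y p i.-1 r C_ok C'_ok size_y pk; first by lia.
  by rewrite (config_le C_ok) ?(ltW left_lt) //; lia.
have b_speed : (0 < k - i)%N -> b = lam * a by move=> ?; apply: speed; lia.
have b_none : (k - i = 0)%N -> b = 0.
  by move=> ?; apply: (pincer_no_right moving); lia.
have := capped_alpha_pays lam_ge0 lam_le1 i_gt0 (pincer_left_ge0 moving) b_speed b_none.
have left_le : C`_i.-1 + a <= z`_i.-1 by rewrite zi (pincer_left_stop moving).
have := potential_advance_left (w := fun=> alpha_sum lam k)
  (capped_alpha lam k) size_C moving i_gt0 alpha_ge0 left_le.
by rewrite subnKC // -/(ftp_potential lam k); lra.
Qed.

Lemma ftp_potential_step_right :
  (i <= p)%N -> ((0 < i < k)%N -> a = lam * b) ->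
  move_cost C C' + ftp_potential lam k C' (sort <=%R (set_nth 0 y p r)) <=
  ftp_potential lam k C y + alpha_sum lam k * `|y`_p - r|.
Proof.
move=> p_ge speed; have i_lt : (i < k)%N by lia.
have right_ge : r <= C`_i by rewrite leNgt (pincer_gap moving) ?size_C // ltnn.
have [||z [zi le_z z_le]] :=
  @ftp_potential_rematch C C' y p i r C_ok C'_ok size_y pk; first by lia.
  by rewrite right_ge (config_le C_ok p_ge pk) orbT.
have a_speed : (0 < i)%N -> a = lam * b by move=> ?; apply: speed; lia.
have n_gt0 : (0 < k - i)%N by lia.
have := capped_alpha_pays lam_ge0 lam_le1 n_gt0 (pincer_right_ge0 moving) a_speed
  (pincer_no_left moving).
have right_le : z`_i <= C`_i - b by rewrite zi (pincer_right_stop moving) ?size_C.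
have := potential_advance_right (w := fun=> alpha_sum lam k)
  (capped_alpha lam k) size_C moving alpha_ge0 right_le.
by rewrite subnK // -/(ftp_potential lam k); lra.
Qed.

End Step.

Lemma ftp_potential_step C y r (p : 'I_k) (C' := lambda_dc lam C r p) :
  config_ok k C -> size y = k ->
  move_cost C C' + ftp_potential lam k C' (sort <=%R (set_nth 0 y p r)) <=
  ftp_potential lam k C y + alpha_sum lam k * `|y`_p - r|.
Proof.
move=> C_ok size_y.
have [i [a [b [moving + C'E]]]] := lambda_dcP r p lam_ge0 C_ok.
rewrite /C' C'E; case: (ltnP p i) => pi speed.
- exact: ftp_potential_step_left.
- exact: ftp_potential_step_right.
Qed.

Lemma alg_cost_le_ftp (C y rs : seq R) (ps : seq 'I_k) :
  (0 < k)%N -> config_ok k C -> size y = k ->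
  alg_cost (lambda_dc lam (k := k)) C rs ps
  <= alpha_k lam k * ftp_cost y rs ps + ftp_potential lam k C y.
Proof.
move=> k_gt0; rewrite alpha_kE //.
elim: rs ps C y => [|r rs IH] [|p ps] C y C_ok size_y /=;
  rewrite ?mulr0 ?add0r ?ftp_potential_ge0 //.
have [C'_ok _] := lambda_dc_serves lam_ge0 r p C_ok.
have size_y' : size (sort <=%R (set_nth 0 y p r)) = k.
  by rewrite size_sort size_set_nth_ltn size_y.
have := IH ps _ _ C'_ok size_y'; have := ftp_potential_step r p C_ok size_y.
by rewrite mulrDr; lra.
Qed.

End FtP.

(** * Comparison with OPT *)

Section Beta.
Variables (R : realType) (lam : R).
Hypothesis lam_gt0 : 0 < lam.

Lemma beta_k1 : beta_k lam 1 = 1.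
Proof. by rewrite /beta_k big_nat1 expr0 invr1. Qed.

Lemma beta_kS n : beta_k lam n.+1 = beta_k lam n + (lam ^+ n)^-1.
Proof. by rewrite /beta_k big_nat_recr. Qed.

Lemma mul_beta_kS n : lam * (beta_k lam n.+1 - 1) = beta_k lam n.
Proof.
rewrite /beta_k big_nat_recl // expr0 invr1 addrC addKr mulr_sumr.
by apply: eq_bigr => i _; rewrite exprS invfM mulVKf ?gt_eqF.
Qed.

Lemma beta_k_homo : {homo beta_k lam : m n / (m <= n)%N >-> m <= n}.
Proof.
apply: homo_leq => [//||n]; first exact: le_trans.
by rewrite beta_kS lerDl invr_ge0 exprn_ge0 // ltW.
Qed.

Lemma beta_k_ge0 n : 0 <= beta_k lam n.
Proof. by apply: sumr_ge0 => i _; rewrite invr_ge0 exprn_ge0 // ltW. Qed.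

Lemma beta_k_ge1 n : (0 < n)%N -> 1 <= beta_k lam n.
Proof. by rewrite -beta_k1; apply: beta_k_homo. Qed.

Lemma beta_k_add m n : lam <= 1 -> (0 < m)%N ->
  beta_k lam m + beta_k lam n.+1 <= beta_k lam (m + n) + 1.
Proof.
move=> lam_le1 m_gt0; elim: n => [|n IH]; first by rewrite addn0 beta_k1.
rewrite addnS (beta_kS n.+1) (beta_kS (m + n)).
have : (lam ^+ n.+1)^-1 <= (lam ^+ (m + n))^-1.
  rewrite lef_pV2 ?posrE ?exprn_gt0 //; apply: ler_wiXn2l => //; first exact: ltW.
  exact: leq_add m_gt0 (leqnn n).
lra.
Qed.

Lemma beta_k_pays n (f d : R) : lam * d <= f ->
  beta_k lam n * d <= (beta_k lam n.+1 - 1) * f.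
Proof.
move=> d_le; rewrite -mul_beta_kS mulrAC mulrC ler_wpM2l //.
by rewrite subr_ge0 beta_k_ge1.
Qed.

End Beta.

Definition opt_weight (R : realType) (lam : R) (k j : nat) : R :=
  beta_k lam j.+1 + beta_k lam (k - j) - 1.

Definition opt_potential (R : realType) (lam : R) (k : nat) : seq R -> seq R -> R :=
  potential (opt_weight lam k) (beta_k lam) k.

Section OPT.
Variables (R : realType) (lam : R) (k : nat).
Hypothesis lam01 : 0 < lam <= 1.
Let lam_gt0 : 0 < lam. Proof. by case/andP: lam01. Qed.
Let lam_ge0 : 0 <= lam. Proof. exact: ltW. Qed.
Let lam_le1 : lam <= 1. Proof. by case/andP: lam01. Qed.

Lemma opt_weight_ge0 j : 0 <= opt_weight lam k j.
Proof.
have := beta_k_ge1 lam_gt0 (ltn0Sn j); have := beta_k_ge0 lam_gt0 (k - j).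
by rewrite /opt_weight; lra.
Qed.

Lemma opt_weight_pred i : (0 < i <= k)%N ->
  opt_weight lam k i.-1 = beta_k lam i + beta_k lam (k - i).+1 - 1.
Proof.
move=> /andP[i_gt0 i_le]; rewrite /opt_weight prednK //.
by rewrite (_ : (k - i.-1 = (k - i).+1)%N) //; lia.
Qed.

Lemma opt_weight_le j : (j < k)%N -> opt_weight lam k j <= beta_k lam k.
Proof.
move=> jk; have := @beta_k_add R lam lam_gt0 j.+1 (k - j.+1) lam_le1 isT.
by rewrite subnKC // subnSK // /opt_weight; lra.
Qed.

Lemma opt_potential_ge0 s x : config_ok k s -> 0 <= opt_potential lam k s x.
Proof.
apply: potential_ge0 => [|j _]; [exact: beta_k_homo | exact: opt_weight_ge0].
Qed.

Lemma opt_potential_move s x x' : size x = k ->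
  opt_potential lam k s x' <= opt_potential lam k s x + beta_k lam k * move_cost x x'.
Proof.
move=> size_x; rewrite /opt_potential /potential /move_cost size_x [leRHS]addrAC lerD2r.
rewrite mulr_sumr -big_split /=; apply: ler_sum => j _.
apply: (le_trans (ler_wpM2l (opt_weight_ge0 j) (ler_distD x`_j _ _))).
by rewrite mulrDr lerD2l ler_wpM2r // opt_weight_le.
Qed.

Section Step.
Variables (C x : seq R) (r : R) (i : nat) (a b : R).
Hypotheses (size_C : size C = k) (moving : pincer C r i a b).

Lemma opt_potential_step_left : (0 < i)%N -> r <= x`_i.-1 -> lam * b <= a ->
  move_cost C (advance C i a b) + opt_potential lam k (advance C i a b) x <=
  opt_potential lam k C x.
Proof.
move=> i_gt0 r_le lamb_le.
have i_le : (0 < i <= k)%N by rewrite i_gt0 -size_C (pincer_size moving).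
have left_le := le_trans (pincer_left_stop moving i_gt0) r_le.
have := potential_advance_left (beta_k lam) size_C moving i_gt0
  (opt_weight_ge0 i) left_le.
have := beta_k_pays lam_gt0 (k - i) lamb_le.
by rewrite opt_weight_pred // /opt_potential /opt_weight; lra.
Qed.

Lemma opt_potential_step_right : (i < k)%N -> x`_i <= r -> lam * a <= b ->
  move_cost C (advance C i a b) + opt_potential lam k (advance C i a b) x <=
  opt_potential lam k C x.
Proof.
rewrite -[in (i < k)%N]size_C => i_lt r_ge lama_le.
have right_ge := le_trans r_ge (pincer_right_stop moving i_lt).
have := potential_advance_right (beta_k lam) size_C moving
  (opt_weight_ge0 i.-1) right_ge.
have := beta_k_pays lam_gt0 i lama_le; rewrite /opt_potential.
have [i0|i_gt0] := posnP i.
  by rewrite (pincer_no_left moving i0) !mulr0 /opt_weight; lra.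
have i_le : (0 < i <= k)%N by rewrite i_gt0 -size_C ltnW.
by rewrite opt_weight_pred // /opt_weight; lra.
Qed.

End Step.

Lemma opt_potential_step C x r (p : 'I_k) (C' := lambda_dc lam C r p) :
  config_ok k C -> config_ok k x -> r \in x ->
  move_cost C C' + opt_potential lam k C' x <= opt_potential lam k C x.
Proof.
move=> C_ok x_ok /(nthP 0)[l]; rewrite (proj1 x_ok) => lk xl; have size_C := proj1 C_ok.
have [i [a [b [moving speed]]]] := lambda_dcP r p lam_ge0 C_ok.
rewrite -/C' => ->.
have a_ge0 := pincer_left_ge0 moving; have b_ge0 := pincer_right_ge0 moving.
have i_le : (i <= k)%N by rewrite -size_C (pincer_size moving).
have sq_le t : 0 <= t -> lam * (lam * t) <= t.
  by move=> t_ge0; rewrite mulrA ler_piMl // mulr_ile1.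
have [l_lt|l_ge] := ltnP l i.
- have i_gt0 : (0 < i)%N by lia.
  apply: (opt_potential_step_left size_C moving i_gt0).
    by rewrite -xl (config_le x_ok); lia.
  have [ik|i_neq] := eqVneq i k.
    by rewrite (pincer_no_right moving) ?mulr0 // size_C.
  have /speed : (0 < i < k)%N by lia.
  by case: ifP => _ ->; rewrite ?sq_le.
- have i_lt : (i < k)%N by lia.
  apply: (opt_potential_step_right size_C moving i_lt).
    by rewrite -xl (config_le x_ok); lia.
  have [i0|i_neq] := eqVneq i 0%N; first by rewrite (pincer_no_left moving) ?mulr0.
  have /speed : (0 < i < k)%N by lia.
  by case: ifP => _ ->; rewrite ?sq_le.
Qed.

Lemma sched_cost_ge0 (x : seq R) Cs : 0 <= sched_cost x Cs.
Proof. by elim: Cs x => //= x' Cs IH x; rewrite addr_ge0 ?move_cost_ge0. Qed.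

Lemma alg_cost_le_sched (C x rs : seq R) (ps : seq 'I_k) (Cs : seq (seq R)) :
  config_ok k C -> config_ok k x -> feasible_sched k rs Cs ->
  alg_cost (lambda_dc lam (k := k)) C rs ps
  <= beta_k lam k * sched_cost x Cs + opt_potential lam k C x.
Proof.
elim: rs ps C x Cs => [|r rs IH] [|p ps] C x Cs C_ok x_ok [size_Cs feas] /=.
1-3: by rewrite addr_ge0 ?mulr_ge0 ?opt_potential_ge0 ?beta_k_ge0 ?sched_cost_ge0.
case: Cs size_Cs feas => [|x' Cs] //= [size_Cs] feas.
have [x'_ok rx'] := feas 0%N isT.
have feas' : feasible_sched k rs Cs by split=> // t; exact: (feas t.+1).
have [C'_ok _] := lambda_dc_serves lam_ge0 r p C_ok.
have := IH ps _ _ _ C'_ok x'_ok feas'.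
have := opt_potential_step p C_ok x'_ok rx'.
have := opt_potential_move C x' (proj1 x_ok).
by rewrite mulrDr; lra.
Qed.

Lemma feasible_sched_constant (rs : seq R) :
  (0 < k)%N -> feasible_sched k rs [seq nseq k r | r <- rs].
Proof.
move=> k_gt0; split; first by rewrite size_map.
move=> t t_lt; rewrite (nth_map 0) // mem_nseq k_gt0 eqxx; split=> //.
split; first by rewrite size_nseq.
by apply/(sortedP 0) => i; rewrite size_nseq => ik; rewrite !nth_nseq ik ltnW.
Qed.

Lemma alg_cost_le_OPT (C rs : seq R) (ps : seq 'I_k) :
  (0 < k)%N -> config_ok k C ->
  alg_cost (lambda_dc lam (k := k)) C rs ps
  <= beta_k lam k * OPT k C rs + opt_potential lam k C C.
Proof.
move=> k_gt0 C_ok.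
have beta_gt0 : 0 < beta_k lam k by apply: lt_le_trans ltr01 (beta_k_ge1 _ _).
rewrite -lerBlDr -ler_pdivrMl //; apply: lb_le_inf.
- exists (sched_cost C [seq nseq k r | r <- rs]), [seq nseq k r | r <- rs].
  by split=> //; exact: feasible_sched_constant.
- move=> _ [Cs [feas ->]]; rewrite ler_pdivrMl // lerBlDr.
  exact: alg_cost_le_sched.
Qed.

End OPT.

(** * Erasability *)

Lemma strict_homo_ord_id (n : nat) (f : 'I_n -> 'I_n) :
  (forall i j : 'I_n, (i < j)%N -> (f i < f j)%N) -> f =1 id.
Proof.
have expanding (g : 'I_n -> 'I_n) :
    (forall i j : 'I_n, (i < j)%N -> (g i < g j)%N) -> forall i : 'I_n, (i <= g i)%N.
  move=> g_homo [m]; elim: m => // m IH m_lt.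
  apply: leq_ltn_trans (IH (ltnW m_lt)) _.
  exact: (g_homo (Ordinal (ltnW m_lt)) (Ordinal m_lt) (ltnSn m)).
move=> f_homo i; apply/val_inj/anti_leq; rewrite (expanding f) // andbT.
have rev_homo (j l : 'I_n) :
    (j < l)%N -> (rev_ord (f (rev_ord j)) < rev_ord (f (rev_ord l)))%N.
  move=> jl; have : (rev_ord l < rev_ord j)%N by rewrite /=; have := ltn_ord l; lia.
  by move/f_homo => /=; have := ltn_ord (f (rev_ord j)); lia.
have := expanding _ rev_homo (rev_ord i); rewrite /= rev_ordK.
by have := ltn_ord i; have := ltn_ord (f i); lia.
Qed.

Definition separated (R : realType) (eps : R) (Y : seq R) : Prop :=
  forall i j, (i < j)%N -> (j < size Y)%N -> eps + eps <= Y`_j - Y`_i.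

Definition near (R : realType) (eps : R) (Y C : seq R) : Prop :=
  forall j, (j < size Y)%N -> `|C`_j - Y`_j| < eps.

Lemma sorted_uniq_separated (R : realType) (Y : seq R) :
  sorted <=%R Y -> uniq Y -> exists2 eps, 0 < eps & separated eps Y.
Proof.
move=> Y_sorted Y_uniq.
have Y_lt : sorted <%R Y by rewrite lt_sorted_uniq_le Y_uniq.
pose I2 := ('I_(size Y) * 'I_(size Y))%type.
pose delta := \big[Num.min/1]_(u : I2 | (u.1 < u.2)%N) (Y`_u.2 - Y`_u.1).
exists (delta / 2) => [|i j ij jY].
  rewrite divr_gt0 // lt_bigmin // => u u_lt; rewrite subr_gt0.
  by apply: (sorted_ltn_nth lt_trans) => //; rewrite inE.
rewrite -splitr.
exact: (@bigmin_le_cond _ _ _ _ (Ordinal (ltn_trans ij jY), Ordinal jY)).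
Qed.

Lemma near_lt (R : realType) (eps : R) (Y C : seq R) i j :
  separated eps Y -> near eps Y C -> (i < j)%N -> (j < size Y)%N -> C`_i < Y`_j - eps.
Proof.
move=> Y_sep C_near ij jY; have := Y_sep i j ij jY.
by have := C_near i (ltn_trans ij jY); rewrite ltr_norml => /andP[_]; lra.
Qed.

Lemma near_gt (R : realType) (eps : R) (Y C : seq R) i j :
  separated eps Y -> near eps Y C -> (j < i)%N -> (i < size Y)%N -> Y`_j + eps < C`_i.
Proof.
move=> Y_sep C_near ji iY; have := Y_sep j i ji iY.
by have := C_near i iY; rewrite ltr_norml => /andP[+ _]; lra.
Qed.

Lemma near_of_covering (R : realType) (k : nat) (eps : R) (Y C : seq R) :
  config_ok k C -> size Y = k -> separated eps Y ->
  (forall j : 'I_k, exists l : 'I_k, `|C`_l - Y`_j| < eps) -> near eps Y C.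
Proof.
move=> C_ok size_Y Y_sep /fin_all_exists[f f_near].
have f_id : f =1 id.
  apply: strict_homo_ord_id => i j ij; rewrite ltnNge; apply/negP => f_le.
  have := config_le C_ok f_le (ltn_ord _).
  have := Y_sep i j ij; rewrite size_Y => /(_ (ltn_ord j)).
  by have := (f_near i, f_near j); rewrite !ltr_norml => -[/andP[? ?] /andP[? ?]]; lra.
move=> j; rewrite size_Y => jk.
by have := f_near (Ordinal jk); rewrite f_id.
Qed.

Section Runs.
Variables (R : realType) (k : nat) (A : mc_alg R k).
Implicit Types (C rs : seq R) (ps : seq 'I_k).

Lemma alg_final_cat C rs ps rs' ps' : size ps = size rs ->
  alg_final A C (rs ++ rs') (ps ++ ps') = alg_final A (alg_final A C rs ps) rs' ps'.
Proof. by elim: rs ps C => [|r rs IH] [|p ps] C //= [/IH]. Qed.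

Lemma alg_cost_cat C rs ps rs' ps' : size ps = size rs ->
  alg_cost A C (rs ++ rs') (ps ++ ps') =
  alg_cost A C rs ps + alg_cost A (alg_final A C rs ps) rs' ps'.
Proof.
elim: rs ps C => [|r rs IH] [|p ps] C //=; first by rewrite add0r.
by move=> [/IH ->]; rewrite addrA.
Qed.

Lemma alg_cost_ge0 C rs ps : 0 <= alg_cost A C rs ps.
Proof.
by elim: rs ps C => [|r rs IH] [|p ps] C //=; rewrite addr_ge0 ?move_cost_ge0.
Qed.

Lemma alg_final_config C rs ps :
  serves A -> config_ok k C -> config_ok k (alg_final A C rs ps).
Proof.
by move=> A_serves; elim: rs ps C => [|r rs IH] [|p ps] C //= /A_serves-/(_ r p)[/IH].
Qed.

(* Every request of a homing run is predicted correctly by FtP started at [Y],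
   which therefore never moves. *)
Definition homing (Y C : seq R) (js : seq 'I_k) : seq R :=
  alg_final A C [seq Y`_j | j : 'I_k <- js] js.

Definition homing_cost (Y C : seq R) (js : seq 'I_k) : R :=
  alg_cost A C [seq Y`_j | j : 'I_k <- js] js.

Lemma homing_cat Y C js js' : homing Y C (js ++ js') = homing Y (homing Y C js) js'.
Proof. by rewrite /homing map_cat alg_final_cat // size_map. Qed.

Lemma homing_cost_cat Y C js js' :
  homing_cost Y C (js ++ js') = homing_cost Y C js + homing_cost Y (homing Y C js) js'.
Proof. by rewrite /homing_cost map_cat alg_cost_cat // size_map. Qed.

Definition settled (eps : R) (Y C : seq R) : Prop :=
  config_ok k C /\ forall js, homing_cost Y C js < eps.

Hypothesis A_serves : serves A.

Lemma settled_homing eps Y C js : settled eps Y C -> settled eps Y (homing Y C js).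
Proof.
move=> [C_ok C_cost]; split=> [|js']; first exact: alg_final_config.
apply: le_lt_trans (C_cost (js ++ js')).
by rewrite homing_cost_cat lerDr alg_cost_ge0.
Qed.

Lemma exists_settled eps Y C bound : 0 < eps -> config_ok k C ->
  (forall js, homing_cost Y C js <= bound) -> exists js, settled eps Y (homing Y C js).
Proof.
move=> eps_gt0 C_ok cost_le; pose costs := range (homing_cost Y C).
have costs_sup : has_sup costs.
  by split; [exists (homing_cost Y C [::]), [::] | exists bound => _ [js _ <-]].
have [_ [js _ <-] js_cost] := sup_adherent eps_gt0 costs_sup.
exists js; split=> [|js']; first exact: alg_final_config.
have : homing_cost Y C (js ++ js') <= sup costs.
  by apply: sup_upper_bound => //; exists (js ++ js').
by rewrite homing_cost_cat; lra.
Qed.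

Lemma settled_near eps Y C :
  size Y = k -> separated eps Y -> settled eps Y C -> near eps Y C.
Proof.
move=> size_Y Y_sep [C_ok C_cost]; apply: (near_of_covering C_ok) => // j.
have [[size_C' _] /(nthP 0)[l]] := A_serves Y`_j j C_ok; rewrite size_C' => lk Yj.
exists (Ordinal lk); apply: le_lt_trans (C_cost [:: j]).
by rewrite /homing_cost /= addr0 -{1}Yj norm_nth_le_move_cost // (proj1 C_ok).
Qed.

End Runs.

Section Homing.
Variables (R : realType) (k : nat) (lam eps : R) (Y : seq R).
Hypotheses (lam01 : 0 <= lam <= 1) (Y_ok : config_ok k Y) (Y_sep : separated eps Y).
Let size_Y : size Y = k. Proof. exact: (proj1 Y_ok). Qed.
Let lam_ge0 : 0 <= lam. Proof. by case/andP: lam01. Qed.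
Let lam_le1 : lam <= 1. Proof. by case/andP: lam01. Qed.
Notation A := (lambda_dc lam (k := k)).
Implicit Types C : seq R.

Lemma ftp_cost_homing js : ftp_cost Y [seq Y`_j | j : 'I_k <- js] js = 0.
Proof.
elim: js => //= j js IH; rewrite subrr normr0 add0r.
by rewrite set_nth_id ?size_Y // (sort_le_id (proj2 Y_ok)).
Qed.

Lemma homing_cost_le_potential C js :
  (0 < k)%N -> config_ok k C -> homing_cost A Y C js <= ftp_potential lam k C Y.
Proof.
move=> k_gt0 C_ok; rewrite -[leRHS]add0r -(mulr0 (alpha_k lam k)).
by rewrite -(ftp_cost_homing js); apply: alg_cost_le_ftp.
Qed.

Lemma home_from_left C (j : 'I_k) (C' := A C Y`_j j) :
  config_ok k C -> near eps Y C -> C`_j < Y`_j ->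
  C'`_j = Y`_j /\ forall l, (l < j)%N -> C'`_l = C`_l.
Proof.
move=> C_ok C_near Cj_lt; have [size_C _] := C_ok; have jk := ltn_ord j.
have [i [a [b [moving speed]]]] := lambda_dcP Y`_j j lam_ge0 C_ok.
rewrite -/C' => ->.
have gap l : (l < k)%N -> (C`_l < Y`_j) = (l < i)%N.
  by move=> lk; apply: (pincer_gap moving); rewrite size_C.
have eps_gt : Y`_j - C`_j < eps.
  by have := C_near j; rewrite size_Y ltr_norml => /(_ jk)/andP[]; lra.
have iE : i = j.+1.
  apply/anti_leq; rewrite -(gap j) // Cj_lt andbT leqNgt; apply/negP => ij.
  have j1k : (j.+1 < k)%N by have := pincer_size moving; rewrite size_C; lia.
  have := near_gt Y_sep C_near (ltnSn j); rewrite size_Y => /(_ j1k).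
  by have := gap _ j1k; rewrite ij; lra.
have left_stop := pincer_left_stop moving; rewrite iE /= in left_stop.
have hit : C`_j + a = Y`_j.
  case: (pincer_hit moving); rewrite iE => -[] // j1k right_hit; rewrite size_C in j1k.
  move: speed; rewrite iE ltnSn j1k => /(_ isT) bE.
  have a_ge0 := pincer_left_ge0 moving.
  have := near_gt Y_sep C_near (ltnSn j); rewrite size_Y => /(_ j1k).
  have : b <= a by rewrite bE ler_piMl.
  by have := left_stop isT; lra.
rewrite iE in moving *; split=> [|l lj]; first by rewrite (advance_left moving).
by apply: advance_other; [rewrite size_C (ltn_trans lj jk) | lia | lia].
Qed.

Lemma home_from_right C (j : 'I_k) (C' := A C Y`_j j) :
  config_ok k C -> near eps Y C -> Y`_j <= C`_j ->
  [/\ C'`_j = Y`_j, (0 < j)%N -> C`_j.-1 <= C'`_j.-1 &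
    forall l, (l < k)%N -> l != j -> l.+1 != j -> C'`_l = C`_l].
Proof.
move=> C_ok C_near Cj_ge; have [size_C _] := C_ok; have jk := ltn_ord j.
have [i [a [b [moving speed]]]] := lambda_dcP Y`_j j lam_ge0 C_ok.
rewrite -/C' => ->.
have gap l : (l < k)%N -> (C`_l < Y`_j) = (l < i)%N.
  by move=> lk; apply: (pincer_gap moving); rewrite size_C.
have eps_gt : C`_j - Y`_j < eps.
  by have := C_near j; rewrite size_Y ltr_norml => /(_ jk)/andP[]; lra.
have left_lt : (0 < j)%N -> C`_j.-1 < Y`_j - eps.
  by move=> j_gt0; apply: near_lt => //; rewrite ?prednK ?size_Y.
have iE : i = j :> nat.
  apply/anti_leq; rewrite leqNgt -(gap j) // -leNgt Cj_ge /=.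
  case: (posnP j) => [-> //|j_gt0]; rewrite -(prednK j_gt0) -gap; last by lia.
  by have := left_lt j_gt0; lra.
have j_lt : (j < size C)%N by rewrite size_C.
have right_stop := pincer_right_stop moving; rewrite iE in right_stop.
have hit : C`_j - b = Y`_j.
  case: (pincer_hit moving); rewrite iE => -[] // j_gt0 left_hit.
  move: speed; rewrite iE ltnn j_gt0 jk => /(_ isT) aE.
  have b_ge0 := pincer_right_ge0 moving.
  have : a <= b by rewrite aE ler_piMl.
  by have := left_lt j_gt0; have := right_stop j_lt; lra.
rewrite iE in moving *; split=> [|j_gt0|l lk lj lj1].
- by rewrite advance_right.
- by rewrite (advance_left moving) // lerDl (pincer_left_ge0 moving).
- by apply: advance_other; rewrite ?size_C.
Qed.

Let A_serves : serves A. Proof. exact: lambda_dc_serves. Qed.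

(* Requesting [Y_j] moves server [j] home, dragging server [j - 1] to the right
   of its home; the defect disappears at the left end of the line. *)
Lemma push_defect_left m j C :
  settled A eps Y C -> (j < m <= k)%N -> Y`_j <= C`_j ->
  (forall l, (l < m)%N -> l != j -> C`_l = Y`_l) ->
  exists js, forall l, (l < m)%N -> (homing A Y C js)`_l = Y`_l.
Proof.
move=> + /andP[jm mk]; elim: j C jm => [|j IH] C jm C_settled Cj_ge C_home.
all: have jk := leq_trans jm mk.
all: have C_near := settled_near A_serves size_Y Y_sep C_settled.
all: have [C'j left_ge others] :=
  home_from_right (j := Ordinal jk) (proj1 C_settled) C_near Cj_ge.
all: have C'_settled := settled_homing A_serves [:: Ordinal jk] C_settled.
  exists [:: Ordinal jk] => -[_|l lm]; first exact: C'j.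
  by rewrite -C_home //; apply: others => //; apply: leq_trans lm mk.
have [|l lm lj|js js_home] := IH _ (ltnW jm) C'_settled.
- by rewrite -(C_home j (ltnW jm)) ?ltn_eqF //; apply: left_ge.
- have [->|lj1] := eqVneq l j.+1; first exact: C'j.
  by rewrite -C_home //; apply: others => //; apply: leq_trans lm mk.
- by exists (Ordinal jk :: js).
Qed.

Lemma home_prefix m C : settled A eps Y C -> (m <= k)%N ->
  exists js, forall l, (l < m)%N -> (homing A Y C js)`_l = Y`_l.
Proof.
move=> C_settled; elim: m => [|m IH] mk; first by exists [::].
have [js js_home] := IH (ltnW mk).
have C1_settled := settled_homing A_serves js C_settled.
set C1 := homing A Y C js in js_home C1_settled.
have [C1m_lt|C1m_ge] := ltP C1`_m Y`_m.
- have C1_near := settled_near A_serves size_Y Y_sep C1_settled.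
  have [C'm C'_home] :=
    home_from_left (j := Ordinal mk) (proj1 C1_settled) C1_near C1m_lt.
  exists (js ++ [:: Ordinal mk]) => l; rewrite homing_cat ltnS leq_eqVlt.
  by case/predU1P => [-> //|lm]; rewrite -js_home //; apply: C'_home.
- have m_in : (m < m.+1 <= k)%N by rewrite ltnSn.
  have [|js' js'_home] := push_defect_left C1_settled m_in C1m_ge.
    by move=> l lm l_neq; apply: js_home; rewrite ltn_neqAle l_neq.
  by exists (js ++ js') => l lm; rewrite homing_cat js'_home.
Qed.

End Homing.

Lemma lambda_dc_erasable (R : realType) (lam : R) (k : nat) :
  (0 < k)%N -> 0 <= lam <= 1 -> erasable (lambda_dc lam (k := k)).
Proof.
move=> k_gt0 lam01 X size_X X_uniq C C_ok; pose Y := sort <=%R X.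
have Y_ok : config_ok k Y by split; rewrite ?size_sort ?sort_le_sorted.
have Y_uniq : uniq Y by rewrite sort_uniq.
have [eps eps_gt0 Y_sep] := sorted_uniq_separated (proj2 Y_ok) Y_uniq.
have A_serves : serves (lambda_dc lam (k := k)).
  by apply: lambda_dc_serves; case/andP: lam01.
have cost_le js := homing_cost_le_potential lam01 Y_ok js k_gt0 C_ok.
have [js js_settled] := exists_settled A_serves eps_gt0 C_ok cost_le.
have [js' js'_home] := home_prefix lam01 Y_ok Y_sep js_settled (leqnn k).
have homeE : homing (lambda_dc lam (k := k)) Y C (js ++ js') = Y.
  have [size_C' _] : config_ok k (homing (lambda_dc lam (k := k)) Y C (js ++ js')).
    exact: alg_final_config.
  apply: (@eq_from_nth _ 0) => [|l]; rewrite size_C' ?(proj1 Y_ok) // => lk.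
  by rewrite homing_cat js'_home.
exists [seq Y`_j | j : 'I_k <- js ++ js'], (js ++ js').
split; [by rewrite size_map | split; last exact: homeE].
apply/allP => r /mapP[j _ ->]; rewrite -(mem_sort <=%R) mem_nth //.
by rewrite (proj1 Y_ok).
Qed.

Theorem theorem1 (R : realType) (k : nat) (lam : R) :
  (1 <= k)%N -> 0 <= lam <= 1 ->
  exists A : mc_alg R k,
    memory_constrained A /\
    forall C0 : seq R, config_ok k C0 ->
      exists c : R, 0 <= c /\
        forall (rs : seq R) (ps : seq 'I_k), size ps = size rs ->
          alg_cost A C0 rs ps
            <= perf_bound lam k (OPT k C0 rs) (pred_error C0 rs ps) + c.
Proof.
move=> k_gt0 lam01; have /andP[lam_ge0 lam_le1] := lam01.
exists (lambda_dc lam (k := k)); split.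
  by split; [exact: lambda_dc_serves | exact: lambda_dc_erasable].
move=> C0 C0_ok; pose c_ftp := ftp_potential lam k C0 C0.
pose c_opt := opt_potential lam k C0 C0.
have c_ftp_le : c_ftp <= Num.max c_ftp c_opt by rewrite le_max lexx.
exists (Num.max c_ftp c_opt); split=> [|rs ps _].
  exact: le_trans (ftp_potential_ge0 lam01 _ C0_ok) c_ftp_le.
have ftp_bound : alg_cost (lambda_dc lam (k := k)) C0 rs ps <=
    alpha_k lam k * (OPT k C0 rs + pred_error C0 rs ps) + Num.max c_ftp c_opt.
  rewrite /pred_error [OPT _ _ _ + _]addrC subrK.
  apply: le_trans (alg_cost_le_ftp lam01 rs ps k_gt0 C0_ok (proj1 C0_ok)) _.
  by rewrite lerD2l.
rewrite /perf_bound; case: ifP => // lam_gt0.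
rewrite -lerBlDr le_min !lerBlDr ftp_bound /=.
have lam01' : 0 < lam <= 1 by rewrite lam_gt0.
apply: le_trans (alg_cost_le_OPT lam01' rs ps k_gt0 C0_ok) _.
by rewrite lerD2l le_max lexx orbT.
Qed.
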